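(* The following bounds hold: (a) $r_k(k+1, 3; P_n) \le 16n$ for all integers $n \ge k \ge 3$; (b) $2n-2 \le r_3(4,3; P_n) \le 3n-4$ for all integers $n \ge 3$; (c) $r_4(5, 4; P_n) \ge 2^{n-2}+1$ for all integers $n\ge 2$.
   Context: For $k\ge 2$, the $k$-uniform tight path $P_n$ has vertices $v_1<\cdots<v_n$ and edges $\{v_j,\dots,v_{j+k-1}\}$ for $j=1,\dots,n-k+1$ (no edges if $n<k$); in a red/blue coloring of the $k$-subsets of $[N]$, a blue copy of $P_n$ is a sequence $x_1<\cdots<x_n$ in $[N]$ with every $k$-set $\{x_j,\dots,x_{j+k-1}\}$ blue. For integers $k\ge 2$, $s>k$, $t\ge 1$ and $n\ge 1$, $r_k(s,t;P_n)$ is the minimum $N$ such that every red/blue coloring of the $k$-subsets of $[N]$ contains a blue copy of $P_n$ or a set of $s$ vertices containing at least $t$ red $k$-subsets. *)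

(* Defs.v *)
From mathcomp Require Import all_boot.

Set Implicit Arguments.
Unset Strict Implicit.
Unset Printing Implicit Defensive.

(* The vertex set [N] is represented by its 0-based copy 'I_N.  A red/blue
   coloring of the k-subsets is a map c on all sets of vertices, c e = true
   meaning that e is red; only the values of c on k-subsets are ever used. *)
Definition coloring (N : nat) := {set 'I_N} -> bool.

Definition red_subsets (N : nat) (c : coloring N) (k : nat) (S : {set 'I_N}) :
    {set {set 'I_N}} :=
  [set e : {set 'I_N} | [&& e \subset S, #|e| == k & c e]].

Definition has_red_clump (N : nat) (c : coloring N) (k s t : nat) : Prop :=
  exists S : {set 'I_N}, #|S| = s /\ t <= #|red_subsets c k S|.

(* 0-based, the edges of the tight path are the windows j, ..., j + k - 1 with
   j + k <= n; there are none if n < k. *)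
Definition has_blue_tight_path (N : nat) (c : coloring N) (k n : nat) : Prop :=
  exists x : 'I_n -> 'I_N,
    (forall i j : 'I_n, i < j -> x i < x j) /\
    (forall j : nat, j + k <= n ->
       c [set x i | i : 'I_n & j <= i < j + k] = false).

Definition arrows (k s t n N : nat) : Prop :=
  forall c : coloring N, has_blue_tight_path c k n \/ has_red_clump c k s t.

(* r = r_k(s, t; P_n).  A relation rather than a function: there is no such r
   when t > 'C(s, k) and n >= k. *)
Definition is_ramsey_number (k s t n r : nat) : Prop :=
  arrows k s t n r /\ forall N : nat, arrows k s t n N -> r <= N.

(* Main.v *)
(** Upper bounds: if no k+1 vertices carry three red edges, keep a blue path
    together with two possible choices y < y' of its last vertex.  A new vertex z
    extends the path after y, or after y', or else y' and then z can both be
    appended after y, for otherwise y, y', z and the k-2 vertices before them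
    carry three red edges.  Among three new vertices two extend the same path,
    which restores the two choices; so 3n - 2k + 1 vertices suffice.
    Lower bounds: for triples, color x < y < z red when {x, y} is one of the
    pairs {2i, 2i+1}; for quadruples, use red for those that split two against
    two in the binary tree with 2^(n-2) leaves. *)

Require Import Defs.
From mathcomp Require Import all_boot zify.
From Stdlib Require Import Classical.

Set Implicit Arguments.
Unset Strict Implicit.
Unset Printing Implicit Defensive.

(** * Least witnesses and the finite Ramsey theorem for k-sets *)

(** Excluded middle stands in for a decision procedure, as [arrows] is a plain proposition. Any [N]
    that arrows thus yields a Ramsey number. *)
Lemma ex_least (P : nat -> Prop) (n : nat) :
  P n -> exists r, P r /\ forall m, P m -> r <= m.
Proof.
elim/ltn_ind: n => n IHn Pn.
have [[m [lt_mn Pm]] | no_m] := classic (exists m, m < n /\ P m).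
  exact: IHn lt_mn Pm.
exists n; split=> // m Pm; rewrite leqNgt; apply/negP => lt_mn.
by apply: no_m; exists m.
Qed.

Lemma subset_of_card (T : finType) (S : {set T}) (a : nat) :
  a <= #|S| -> exists2 A : {set T}, A \subset S & #|A| = a.
Proof.
elim: a => [|a IHa] le_aS; first by exists set0; rewrite ?sub0set ?cards0.
have [A sAS cardA] := IHa (ltnW le_aS).
have /set0Pn[x] : S :\: A != set0.
  by rewrite -card_gt0 cardsD (setIidPr sAS) cardA subn_gt0.
rewrite inE => /andP[xA xS]; exists (x |: A); last by rewrite cardsU1 xA cardA.
by rewrite subUset sub1set xS.
Qed.

(** Induction on [k], then on [a] and [b], through the link of a vertex [v]. The coloring lives on
    an arbitrary finite type and the host set [S] varies, so that the statement can be reapplied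
    inside a subset. *)
Lemma ramsey (k a b : nat) :
  exists N, forall (T : finType) (c : {set T} -> bool) (S : {set T}),
    N <= #|S| ->
    (exists A : {set T}, [/\ A \subset S, #|A| = a &
       forall e : {set T}, e \subset A -> #|e| = k -> c e]) \/
    (exists B : {set T}, [/\ B \subset S, #|B| = b &
       forall e : {set T}, e \subset B -> #|e| = k -> ~~ c e]).
Proof.
elim: k a b => [|k IHk] a b.
  exists (maxn a b) => T c S; rewrite geq_max => /andP[leaS lebS].
  have [A sAS cA] := subset_of_card leaS.
  have [B sBS cB] := subset_of_card lebS.
  case c0: (c set0); [left; exists A | right; exists B]; split=> // e _ /eqP.
    by rewrite cards_eq0 => /eqP->.
  by rewrite cards_eq0 => /eqP->; rewrite c0.
have empty (T : finType) (e : {set T}) : e \subset set0 -> #|e| <> k.+1.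
  by rewrite subset0 => /eqP->; rewrite cards0.
elim: a b => [|a IHa] b.
  exists 0 => T c S _; left; exists set0; split; rewrite ?sub0set ?cards0 //.
  by move=> e /empty.
elim: b => [|b [N1 N1P]].
  exists 0 => T c S _; right; exists set0; split; rewrite ?sub0set ?cards0 //.
  by move=> e /empty.
have [N2 N2P] := IHa b.+1.
(* The link coloring [e] to [c (v |: e)] is monochromatic on some set of size [N2] (red) or [N1]
   (blue). Inside it, a red [a]-set or a blue [b]-set can still gain [v], while the other outcome is
   already large enough. *)
have [N NP] := IHk N2 N1.
exists N.+1 => T c S ltNS.
have /card_gt0P[v vS] : 0 < #|S| by apply: leq_trans ltNS.
have leNS : N <= #|S :\ v| by move: ltNS; rewrite (cardsD1 v) vS.
have sub_rest (A A' : {set T}) : A \subset S :\ v -> A' \subset A ->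
    [/\ v \notin A', v |: A' \subset S & A' \subset S].
  rewrite subsetD1 => /andP[sAS vA] sA'A; have sA'S := subset_trans sA'A sAS.
  by rewrite subUset sub1set vS sA'S; split=> //; apply: contra vA => /(subsetP sA'A).
have cone (A A' e : {set T}) : A' \subset A -> e \subset v |: A' ->
    #|e| = k.+1 -> e \subset A' \/
    [/\ e :\ v \subset A, #|e :\ v| = k & v |: (e :\ v) = e].
  move=> sA'A seA' ce; case: (boolP (v \in e)) => [ve|ve]; last first.
    left; apply/subsetP => x xe; move: (subsetP seA' x xe); rewrite !inE.
    by case/orP=> // /eqP xv; rewrite -xv xe in ve.
  right; split; last by rewrite setD1K.
    by apply: subset_trans sA'A; rewrite subDset.
  by move: ce; rewrite (cardsD1 v) ve => -[].
have [[A [sAS cA redA]] | [B [sBS cB bluB]]] := NP T (fun e => c (v |: e)) _ leNS.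
- have [|[A' [sA'A cA' redA']]|[B [sBA cB bluB]]] := N2P T c A; first by rewrite cA.
    have [vA' svA'S _] := sub_rest _ _ sAS sA'A.
    left; exists (v |: A'); split=> //; first by rewrite cardsU1 vA' cA'.
    move=> e seA' ce; case: (cone _ _ _ sA'A seA' ce) => [?|[? ? <-]].
      exact: redA'.
    exact: redA.
  by right; exists B; split=> //; have [] := sub_rest _ _ sAS sBA.
- have [|[A [sAB cA redA]]|[B' [sB'B cB' bluB']]] := N1P T c B; first by rewrite cB.
    by left; exists A; split=> //; have [] := sub_rest _ _ sBS sAB.
  have [vB' svB'S _] := sub_rest _ _ sBS sB'B.
  right; exists (v |: B'); split=> //; first by rewrite cardsU1 vB' cB'.
  move=> e seB' ce; case: (cone _ _ _ sB'B seB' ce) => [?|[? ? <-]].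
    exact: bluB'.
  exact: bluB.
Qed.

(** * Red edges among k+1 vertices, and blue paths as lists *)

(** Each [k]-subset of [S] omits exactly one vertex. For a red one this vertex is neither [u] nor
    [v], which leaves [k.-1] possibilities. *)
Lemma red_clump_le (N k : nat) (c : coloring N) (S : {set 'I_N}) (u v : 'I_N) :
  u != v -> u \in S -> v \in S -> #|S| = k.+1 ->
  ~~ c (S :\ u) -> ~~ c (S :\ v) -> #|red_subsets c k S| <= k.-1.
Proof.
move=> uv uS vS cS cu cv.
pose T := S :\ u :\ v.
have -> : k.-1 = #|T|.
  by move: cS; rewrite (cardsD1 u) uS (cardsD1 v) !inE eq_sym uv vS => -[<-].
apply: leq_trans (leq_imset_card (fun x => S :\ x) (mem T)).
apply/subset_leq_card/subsetP => e; rewrite inE => /and3P[seS /eqP ce red_e].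
have : #|S :\: e| == 1 by rewrite cardsD (setIidPr seS) cS ce subSnn.
case/cards1P => x Ex.
have xS : x \in S by have := set11 x; rewrite -Ex inE => /andP[].
have Ee : e = S :\ x by rewrite -Ex setDDr setDv set0U (setIidPr seS).
apply/imsetP; exists x => //; rewrite !inE xS andbT.
by apply/andP; split; apply: contraTneq red_e => xE; rewrite Ee xE.
Qed.

Lemma red_clump3 (N k : nat) (c : coloring N) (S : {set 'I_N}) (u v w : 'I_N) :
  uniq [:: u; v; w] -> {subset [:: u; v; w] <= S} -> #|S| = k.+1 ->
  c (S :\ u) -> c (S :\ v) -> c (S :\ w) -> has_red_clump c k k.+1 3.
Proof.
move=> Uuvw sS cS cu cv cw; exists S; split=> //.
have inj : {in [set x in [:: u; v; w]] &, injective (fun x => S :\ x)}.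
  move=> x y; rewrite inE => /sS xS _ /setP/(_ x).
  by rewrite !in_setD1 eqxx xS andbT /=; case: eqVneq.
rewrite -(_ : #|[set x in [:: u; v; w]]| = 3); last by rewrite cardsE (card_uniqP Uuvw).
rewrite -(card_in_imset inj); apply/subset_leq_card/subsetP => e /imsetP[x xs ->].
have xS : x \in S by apply: sS; rewrite inE in xs.
rewrite inE subD1set /=; apply/andP; split.
  by move: cS; rewrite (cardsD1 x) xS add1n => -[->].
by move: xs; rewrite !inE => /or3P[] /eqP->.
Qed.

(* Vertices are listed from the last one back to the first. *)
Fixpoint blue_path (N : nat) (c : coloring N) (k : nat) (p : seq 'I_N) : bool :=
  if p is y :: q then
    [&& all (fun x : 'I_N => x < y) q, (k <= size p) ==> ~~ c [set x in take k p]
      & blue_path c k q]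
  else true.

Lemma blue_path_drop (N : nat) (c : coloring N) (k m : nat) (p : seq 'I_N) :
  blue_path c k p -> blue_path c k (drop m p).
Proof. by elim: p m => [|y p IHp] [|m] //= /and3P[_ _ /IHp]. Qed.

Lemma blue_path_pairwise (N : nat) (c : coloring N) (k : nat) (p : seq 'I_N) :
  blue_path c k p -> pairwise (fun y x : 'I_N => x < y) p.
Proof. by elim: p => [|y p IHp] //= /and3P[-> _ /IHp]. Qed.

Lemma blue_path_uniq (N : nat) (c : coloring N) (k : nat) (p : seq 'I_N) :
  blue_path c k p -> uniq p.
Proof.
move=> /blue_path_pairwise; apply: (@pairwise_uniq _ (fun y x : 'I_N => x < y)).
by move=> x; rewrite /= ltnn.
Qed.

(** Dropping from the head keeps the [n] earliest vertices. Path index [i] then sits at list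
    position [n - i.+1], so dropping [n - (j + k)] more entries brings the window starting at [j] to
    the head, where [blue_path] tests it. *)
Lemma has_blue_tight_path_of_blue_path (N : nat) (c : coloring N) (k n : nat)
    (p : seq 'I_N) :
  0 < k -> n <= size p -> blue_path c k p -> has_blue_tight_path c k n.
Proof.
move=> k_gt0 le_np /(blue_path_drop (size p - n)).
have : size (drop (size p - n) p) = n by rewrite size_drop subKn.
move: (drop _ _) => q sz_q blue_q.
have sz_rq : size (rev q) == n by rewrite size_rev sz_q.
have xE x0 (i : 'I_n) : tnth (Tuple sz_rq) i = nth x0 q (n - i.+1).
  by rewrite (tnth_nth x0) /= nth_rev ?sz_q.
exists (tnth (Tuple sz_rq)); split=> [i j lt_ij | j le_jkn].
  have x0 := tnth (Tuple sz_rq) i; rewrite !(xE x0).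
  have /(pairwiseP x0) := blue_path_pairwise blue_q.
  by apply; rewrite ?inE ?sz_q; have := ltn_ord j; have := ltn_ord i; lia.
have := blue_path_drop (n - (j + k)) blue_q.
have x0 : 'I_N by apply: (tnth (Tuple sz_rq)); exists j; lia.
have sz_d : size (drop (n - (j + k)) q) = j + k by rewrite size_drop sz_q subKn.
suff -> : [set tnth (Tuple sz_rq) i | i : 'I_n & j <= i < j + k] =
          [set x in take k (drop (n - (j + k)) q)].
  case: (drop _ q) sz_d => [|y r] /= sz_r; first by lia.
  by case/and3P => _ + _; rewrite sz_r leq_addl /= => /negbTE.
apply/setP => y; rewrite inE; apply/imsetP/idP => [[i] |].
  rewrite inE (xE x0) => /andP[leji ltijk] ->.
  have -> : n - i.+1 = n - (j + k) + (j + k - i.+1) by have := ltn_ord i; lia.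
  rewrite -nth_drop -(@nth_take k); last by lia.
  by apply: mem_nth; rewrite size_take sz_d; case: ifP; lia.
case/(nthP x0) => i; rewrite size_take sz_d => lti <-.
have ltik : i < k by move: lti; case: ifP; lia.
have lt : j + k - i.+1 < n by lia.
exists (Ordinal lt); first by rewrite inE /=; lia.
by rewrite (xE x0) /= nth_take // nth_drop; congr nth; lia.
Qed.

(** * Upper bound: growing a blue path with two choices of its last vertex *)

Section TightPathUpperBound.

Variables (N h : nat) (c : coloring N).
Let k := h.+3.
Hypothesis no_clump : ~ has_red_clump c k k.+1 3.

(** The list [s] holds [z], [y'], [y] and the last [h.+1], that is k-2, vertices of [p]: k+1 in all.
    If both single extensions fail, omitting [y'] or [y] from [s] gives a red edge, so every other
    omission gives a blue one. *)
Lemma fork_extend (p : seq 'I_N) (y y' z : 'I_N) :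
  y < y' -> y' < z -> h < size p ->
  blue_path c k (y :: p) -> blue_path c k (y' :: p) ->
  [|| blue_path c k (z :: y :: p), blue_path c k (z :: y' :: p) |
      blue_path c k (y' :: y :: p) && blue_path c k (z :: y' :: y :: p)].
Proof.
move=> lt_yy' lt_y'z lt_hp bluey bluey'.
have lt_yz := ltn_trans lt_yy' lt_y'z.
have [/= /and3P[ally _ bluep] /= /and3P[ally' _ _]] := (bluey, bluey').
have allz : all (fun x : 'I_N => x < z) p.
  by apply: sub_all ally => x /= lt_xy; apply: ltn_trans lt_yz.
pose s := z :: y' :: y :: take h.+1 p.
have Us : uniq s.
  have : pairwise (fun u v : 'I_N => v < u) (z :: y' :: y :: p).
    by rewrite /= lt_yy' lt_y'z lt_yz allz ally ally' (blue_path_pairwise bluep).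
  move/pairwise_uniq => Us; have {Us}: uniq (z :: y' :: y :: p).
    by apply: Us => x; rewrite /= ltnn.
  by rewrite -[z :: _](cat_take_drop h.+4) cat_uniq => /and3P[].
have cS : #|[set x in s]| = k.+1.
  by rewrite cardsE (card_uniqP Us) /= size_takel.
have remS u : [set x in s] :\ u = [set x in rem u s].
  by apply/setP => x; rewrite !inE mem_rem_uniq // !inE.
have def_tp : take h.+1 p = rcons (take h p) (nth z p h) by rewrite (take_nth z).
(* The earliest vertex of [s]: omitting it leaves the last window of [z :: y' :: y :: p]. *)
set x1 := nth z p h in def_tp.
have [zy' zy zx1] : [/\ z != y', z != y & z != x1].
  move: Us; rewrite /s def_tp /= !inE !mem_rcons !inE !negb_or.
  by case/andP=> /and4P[].
have [y'y y'x1 yx1] : [/\ y' != y, y' != x1 & y != x1].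
  move: Us; rewrite /s def_tp /= !inE !mem_rcons !inE !negb_or.
  by case/and4P=> _ /and3P[-> -> _] /andP[->].
have x1p : x1 \notin take h p by move: Us; rewrite /s def_tp /= rcons_uniq => /and5P[].
have rz : rem z s = y' :: y :: take h.+1 p by rewrite /= eqxx.
have ry' : rem y' s = z :: y :: take h.+1 p by rewrite /= eqxx (negbTE zy').
have ry : rem y s = z :: y' :: take h.+1 p.
  by rewrite /= eqxx (negbTE zy) (negbTE y'y).
have def_s : s = rcons [:: z, y', y & take h p] x1 by rewrite /s def_tp.
have rx1 : [set x in s] :\ x1 = [set x in [:: z, y', y & take h p]].
  apply/setP => w; rewrite in_setD1 2![w \in [set _ in _]]in_set.
  rewrite def_s mem_rcons [in LHS]in_cons.
  case: eqVneq => [-> /=|_] //; apply/esym/negbTE.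
  by rewrite !inE !negb_or ![x1 == _]eq_sym zx1 y'x1 yx1 x1p.
have in_s : {subset [:: z; y'; y; x1] <= [set x in s]}.
  move=> x; rewrite !inE def_tp mem_rcons inE.
  by case/or4P=> ->; rewrite ?orbT.
rewrite /= !ltnS lt_hp (ltnW lt_hp) allz ally ally' lt_yy' lt_y'z lt_yz bluep /=.
move: bluey bluey' => /= /and3P[_ -> _] /and3P[_ -> _]; rewrite !andbT /=.
case: (boolP (c [set x in [:: z, y & take h.+1 p]])) => //= red1.
case: (boolP (c [set x in [:: z, y' & take h.+1 p]])) => //= red2.
have -> : c [set x in [:: y', y & take h.+1 p]] = false.
  apply/negP => red3; apply: no_clump.
  apply: (@red_clump3 _ _ _ [set x in s] z y' y); rewrite ?remS ?rz ?ry' ?ry //.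
    by rewrite /= !inE !negb_or zy' zy y'y.
  by move=> x xs; apply: in_s; move: xs; rewrite !inE => /or3P[] ->; rewrite ?orbT.
rewrite /= andbT; apply/negP => red3; apply: no_clump.
apply: (@red_clump3 _ _ _ [set x in s] y' y x1); rewrite ?rx1 ?remS ?ry' ?ry //.
  by rewrite /= !inE !negb_or y'y y'x1 yx1.
by move=> x xs; apply: in_s; move: xs; rewrite !inE => /or3P[] ->; rewrite ?orbT.
Qed.

(** Both paths have at least [m] vertices. As [y'] is the largest vertex in use, all vertices from
    [b] on are still free. *)
Definition forked (m b : nat) : Prop :=
  exists (p : seq 'I_N) (y y' : 'I_N),
    [/\ m <= (size p).+1, y < y' < b, blue_path c k (y :: p)
      & blue_path c k (y' :: p)].

Lemma forked_start : h.+3 <= N -> forked h.+2 h.+3.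
Proof.
move=> le_N.
pose x i : 'I_N := insubd (Ordinal le_N) i.
have xE i : i < k -> x i = i :> nat.
  by move=> lt_i; rewrite val_insubd (leq_trans lt_i le_N).
pose p j := rev (map x (iota 0 j)).
have sz_p j : size (p j) = j by rewrite size_rev size_map size_iota.
have blue_cons j y : j <= y < k -> j.+1 < k -> blue_path c k (p j) ->
    blue_path c k (x y :: p j).
  move=> /andP[le_jy lt_yk] lt_jk bp; rewrite /= bp sz_p leqNgt lt_jk /= andbT.
  rewrite all_rev all_map; apply/allP => i; rewrite mem_iota => /andP[_ lt_ij].
  by rewrite /= !xE //; lia.
have blue_p j : j <= h.+1 -> blue_path c k (p j).
  elim: j => [|j IHj] // le_jh.
  rewrite /p -addn1 iotaD map_cat rev_cat.
  by apply: blue_cons; [lia | lia | apply: IHj; lia].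
exists (p h.+1), (x h.+1), (x h.+2); split; rewrite ?sz_p //.
- by rewrite !xE // /k; lia.
- by apply: blue_cons (blue_p _ _) => //; rewrite /k; lia.
- by apply: blue_cons (blue_p _ _) => //; rewrite /k; lia.
Qed.

(** The new vertices are [b], [b + 1] and [b + 2]. By pigeonhole, two of them extend the same path,
    which becomes the common part of the next fork. *)
Lemma forked_extend (m b : nat) :
  h.+2 <= m -> b + 3 <= N -> forked m b -> forked m.+1 (b + 3).
Proof.
move=> le_hm le_bN [p [y [y' [le_mp /andP[lt_yy' lt_y'b] bluey bluey']]]].
have lt_hp : h < size p by lia.
have lts i : i < 3 -> b + i < N by lia.
pose z i (lt_i : i < 3) := Ordinal (lts i lt_i).
have ext i (lt_i : i < 3) : y' < z i lt_i by rewrite /=; lia.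
have {}ext i (lt_i : i < 3) := fork_extend lt_yy' (ext i lt_i) lt_hp bluey bluey'.
have new q i j (lt_i : i < 3) (lt_j : j < 3) : i < j -> m <= size q ->
    blue_path c k (z i lt_i :: q) -> blue_path c k (z j lt_j :: q) ->
    forked m.+1 (b + 3).
  by move=> lt_ij le_mq bi bj; exists q, (z i lt_i), (z j lt_j); split; rewrite //=; lia.
have zlast i (lt_i : i < 3) : y' < z i lt_i < b + 3 by rewrite /=; lia.
have [l0 l1 l2] : [/\ 0 < 3, 1 < 3 & 2 < 3] by [].
have Ny : m <= size (y :: p) by [].
have Ny' : m <= size (y' :: p) by [].
have Nyy' : m <= size (y' :: y :: p) by rewrite ltnW.
have pigeon (P Q : forall i, i < 3 -> bool) :
    (forall i j li lj, i < j -> P i li -> P j lj -> forked m.+1 (b + 3)) ->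
    (forall i j li lj, i < j -> Q i li -> Q j lj -> forked m.+1 (b + 3)) ->
    (forall i li, P i li || Q i li) -> forked m.+1 (b + 3).
  move=> HP HQ HPQ.
  case/orP: (HPQ 0 l0) => h0; case/orP: (HPQ 1 l1) => h1;
    case/orP: (HPQ 2 l2) => h2;
    (try by [apply: HP h0 h1 | apply: HP h0 h2 | apply: HP h1 h2]);
    by [apply: HQ h0 h1 | apply: HQ h0 h2 | apply: HQ h1 h2].
(* Three possible bases would defeat the pigeonhole. But if [y'] can follow [y], a new vertex
   extending [y :: p] forks with [y'] at once; otherwise only [y' :: p] and [y' :: y :: p] remain as
   bases. If [y'] cannot follow [y], the bases are [y :: p] and [y' :: p]. *)
case byy': (blue_path c k (y' :: y :: p)).
- have [[i [li bi]] | no_ext] :=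
    classic (exists i (li : i < 3), blue_path c k (z i li :: y :: p)).
    by exists (y :: p), y', (z i li); split.
  apply: (pigeon (fun i li => blue_path c k (z i li :: y' :: p))
                 (fun i li => blue_path c k (z i li :: y' :: y :: p))).
  + by move=> i j li lj lt_ij; apply: new.
  + by move=> i j li lj lt_ij; apply: new.
  + move=> i li; case/orP: (ext i li) => [bi|]; first by case: no_ext; exists i, li.
    by rewrite byy'.
- apply: (pigeon (fun i li => blue_path c k (z i li :: y :: p))
                 (fun i li => blue_path c k (z i li :: y' :: p))).
  + by move=> i j li lj lt_ij; apply: new.
  + by move=> i j li lj lt_ij; apply: new.
  + by move=> i li; have := ext i li; rewrite byy' orbF.
Qed.

Lemma forked_long (m : nat) : h.+3 + 3 * m <= N -> forked (h.+2 + m) (h.+3 + 3 * m).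
Proof.
elim: m => [|m IHm] leN; first by rewrite muln0 !addn0 in leN *; apply: forked_start.
have -> : h.+3 + 3 * m.+1 = h.+3 + 3 * m + 3 by lia.
by rewrite addnS; apply: forked_extend; [lia | lia | apply: IHm; lia].
Qed.

(** The final step needs no new fork, so a single further vertex suffices instead of three. *)
Lemma blue_path_long (m : nat) :
  h.+3 + 3 * m < N -> exists2 p, h.+3 + m <= size p & blue_path c k p.
Proof.
move=> ltN.
have [p [y [y' [le_mp /andP[lt_yy' lt_y'b] bluey bluey']]]] := forked_long (ltnW ltN).
have lt_y'z : y' < Ordinal ltN by [].
have lt_hp : h < size p by lia.
case/or3P: (fork_extend lt_yy' lt_y'z lt_hp bluey bluey') => [? | ? | /andP[_ ?]];
  [exists (Ordinal ltN :: y :: p) | exists (Ordinal ltN :: y' :: p) |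
   exists (Ordinal ltN :: y' :: y :: p)] => //=; lia.
Qed.

End TightPathUpperBound.

Lemma arrows_clump3 (k n : nat) :
  3 <= k -> k <= n -> arrows k k.+1 3 n (3 * n - 2 * k + 1).
Proof.
move=> le3k le_kn c.
have [clump|no_clump] := classic (has_red_clump c k k.+1 3).
  by right.
left; case: k le3k le_kn c no_clump => [|[|[|h]]] // _ le_kn c no_clump.
(* With [m = n - k], the vertices used number k + 3(n - k) + 1 = 3n - 2k + 1. *)
have [|p le_p bp] := @blue_path_long _ h c no_clump (n - h.+3); first by lia.
by apply: has_blue_tight_path_of_blue_path bp; lia.
Qed.

(** * Existence of the Ramsey numbers *)

Lemma enum_set_sorted (N : nat) (S : {set 'I_N}) :
  sorted (fun x y : 'I_N => x < y) (enum S).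
Proof.
apply: sorted_filter => [y x z|]; first exact: ltn_trans.
by rewrite -enumT; have := iota_ltn_sorted 0 N; rewrite -val_enum_ord sorted_map.
Qed.

Lemma blue_path_of_blue_clique (N : nat) (c : coloring N) (k : nat) (p : seq 'I_N) :
  pairwise (fun y x : 'I_N => x < y) p ->
  (forall e : {set 'I_N}, e \subset p -> #|e| = k -> ~~ c e) ->
  blue_path c k p.
Proof.
elim: p => [|y p IHp] //= /andP[ally pwp] bluep; rewrite ally IHp //=; last first.
  move=> e /subsetP sep; apply: bluep.
  by apply/subsetP => x /sep xp; rewrite inE xp orbT.
rewrite andbT; apply/implyP => le_k; apply: bluep.
  by apply/subsetP => x; rewrite inE => /mem_take.
have Uyp : uniq (y :: p).
  apply: (@pairwise_uniq _ (fun y x : 'I_N => x < y)); last by rewrite /= ally.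
  by move=> x; rewrite /= ltnn.
by rewrite cardsE (card_uniqP (take_uniq _ Uyp)) size_takel.
Qed.

(** A red clique on [s] vertices carries all ['C(s, k)] edges, and a blue clique on [n] vertices,
    listed in order, is a blue path. Part (c) takes the existence of its Ramsey number from here. *)
Lemma arrows_clique (k s n : nat) :
  0 < k -> exists N, arrows k s 'C(s, k) n N.
Proof.
move=> k_gt0; have [N NP] := ramsey k s n; exists N => c.
have [|[A [_ cA redA]]|[B [_ cB bluB]]] := NP _ c [set: 'I_N].
- by rewrite cardsT card_ord.
- right; exists A; split=> //; rewrite -cA -cards_draws; apply/subset_leq_card.
  apply/subsetP => e; rewrite !inE => /andP[seA /eqP ce].
  by rewrite seA ce eqxx redA.
- left; apply: (@has_blue_tight_path_of_blue_path _ _ _ _ (rev (enum B))) => //.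
    by rewrite size_rev -cardE cB.
  apply: blue_path_of_blue_clique => [|e /subsetP seB].
    rewrite -sorted_pairwise ?rev_sorted; first exact: enum_set_sorted.
    by move=> y x z /= lt_yx lt_zy; apply: ltn_trans lt_yx.
  apply: bluB; apply/subsetP => x /seB.
  by rewrite mem_rev mem_enum.
Qed.

(** * Lower bound for triples *)

(** Indexing by [nat] frees the arithmetic on positions from bound proofs; positions from [n] on
    carry the default of [inord]. *)
Lemma blue_tight_path_seq (N : nat) (c : coloring N) (k n : nat) :
  0 < n -> has_blue_tight_path c k n ->
  exists X : nat -> 'I_N, (forall i j, i < j < n -> X i < X j) /\
    (forall j, j + k <= n -> ~~ c [set y in map X (iota j k)]).
Proof.
case: n => // n _ [x [x_inc x_blue]]; exists (fun i => x (inord i)); split.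
  by move=> i j lt_ij; apply: x_inc; rewrite !inordK; lia.
move=> j /[dup] le_jk /x_blue cF; apply/negP; rewrite -[X in ~ X]/(_ = true).
suff -> : [set y in map (fun i => x (inord i)) (iota j k)] =
          [set x i | i : 'I_n.+1 & j <= i < j + k] by rewrite cF.
apply/setP => y; rewrite inE; apply/mapP/imsetP => [[i]|[i]].
  rewrite mem_iota => lt_i ->; exists (inord i) => //.
  by rewrite inE inordK //; lia.
rewrite inE => lt_i ->; exists (i : nat); first by rewrite mem_iota.
by rewrite inord_val.
Qed.

Definition pair_first_red (N : nat) : coloring N := fun e =>
  [exists x in e, [exists y in e, [exists z in e,
    (x < y < z) && (x %/ 2 == y %/ 2)]]].

Lemma not_arrows3 (n N : nat) : 3 <= n -> N <= 2 * n - 3 -> ~ arrows 3 4 3 n N.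
Proof.
move=> le3n leN /(_ (@pair_first_red N)) [/blue_tight_path_seq|[S [cS]]].
  case=> [|X [X_inc X_blue]]; first by lia.
  have half j : j + 3 <= n -> X j %/ 2 < X j.+1 %/ 2.
    move=> /[dup] le_j /X_blue /= blue_j; rewrite ltnNge; apply: contra blue_j => le_half.
    have [lt1 lt2] : X j < X j.+1 /\ X j.+1 < X j.+2 by split; apply: X_inc; lia.
    apply/existsP; exists (X j); rewrite !inE eqxx /=.
    apply/existsP; exists (X j.+1); rewrite !inE eqxx orbT /=.
    apply/existsP; exists (X j.+2); rewrite !inE eqxx !orbT /=.
    by rewrite lt1 lt2 eqn_leq le_half leq_div2r // ltnW.
  have far j : j + 2 <= n -> j <= X j %/ 2.
    by elim: j => [|j IHj] // le_j; apply: leq_ltn_trans (IHj _) (half _ _); lia.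
  (* The vertex at position n-2 is at least 2(n-2), so the last one is at least 2n-3, outside the
     vertex set. *)
  have := far (n - 2); have := X_inc (n - 2) n.-1; have := ltn_ord (X n.-1); lia.
apply/negP; rewrite -ltnNge ltnS.
have := enum_set_sorted S; have := mem_enum S.
have : size (enum S) = 4 by rewrite -cardE.
case: (enum S) => [|a [|b [|d [|e []]]]] // _ memS /= /and4P[lt_ab lt_bd lt_de _].
have inS x : x \in S -> [\/ x = a :> nat, x = b :> nat, x = d :> nat | x = e :> nat].
  by rewrite -memS !inE => /or4P[]/eqP->; constructor.
have tri (x y z : 'I_N) : [/\ x \in S, y \in S & z \in S] -> x < y < z ->
    x = a :> nat /\ y = b :> nat \/ [/\ x <= b, y = d :> nat & z = e :> nat].
  case=> /inS xs /inS ys /inS zs lt_xyz.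
  by case: ys => ys; case: zs => zs; case: xs => xs;
    first [lia | left; split; lia | right; split; lia].
have [aS bS dS eS] : [/\ a \in S, b \in S, d \in S & e \in S].
  by rewrite -!memS !inE !eqxx !orbT.
have neq (x y : 'I_N) : x != y -> x <> y :> nat by move=> /eqP nxy /val_inj.
have nred (u : 'I_N) : (forall x y z, [/\ x \in S, y \in S & z \in S] ->
    [/\ x <> u :> nat, y <> u :> nat & z <> u :> nat] -> x < y < z -> x %/ 2 <> y %/ 2) ->
    ~~ pair_first_red (S :\ u).
  move=> nred_u; apply/negP => /existsP[x /andP[]]; rewrite in_setD1.
  move=> /andP[/neq xu xS] /existsP[y /andP[]]; rewrite in_setD1.
  move=> /andP[/neq yu yS] /existsP[z /andP[]]; rewrite in_setD1.
  move=> /andP[/neq zu zS] /andP[ltxyz /eqP].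
  exact: (nred_u x y z).
have half_d (x : 'I_N) : x <= b -> x %/ 2 = d %/ 2 -> b %/ 2 = d %/ 2.
  move=> le_xb eq_xd; apply/eqP; rewrite eqn_leq (leq_div2r 2 (ltnW lt_bd)).
  by rewrite -eq_xd (leq_div2r 2 le_xb).
(* If [a] and [b] are paired, [d] lies in a later pair, so the triples omitting [a] or [b] are blue.
   If not, the triples omitting [d] or [e] start with [a], [b] and are blue. Either way at most two
   are red. *)
have [eq_ab | neq_ab] := eqVneq (a %/ 2) (b %/ 2).
  have neq_bd : b %/ 2 <> d %/ 2 by move: eq_ab lt_ab lt_bd; clear; lia.
  apply: (@red_clump_le _ 3 _ _ a b) => //; first by rewrite neq_ltn lt_ab.
    apply: nred => x y z xyzS [xa ya za] /(tri _ _ _ xyzS)[[] // | [le_xb -> _]].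
    by move/half_d => /(_ le_xb).
  apply: nred => x y z xyzS [xb yb zb] /(tri _ _ _ xyzS)[[] // | [le_xb -> _]].
  by move/half_d => /(_ le_xb).
apply: (@red_clump_le _ 3 _ _ d e) => //; first by rewrite neq_ltn lt_de.
  apply: nred => x y z xyzS [xd yd zd] /(tri _ _ _ xyzS)[[-> ->] | [] //].
  exact/eqP.
apply: nred => x y z xyzS [xe ye ze] /(tri _ _ _ xyzS)[[-> ->] | [] //].
exact/eqP.
Qed.

(** * Lower bound for quadruples: the binary tree coloring *)

(** The fibres of [y %/ 2 ^ i] are the subtrees of height [i]. For a 4-set, some level must show two
    subtrees with two leaves each; these pairs stay intact up to the topmost split. *)
Definition dyadic_red (m N : nat) : coloring N := fun e =>
  [exists i : 'I_m, [forall x in e,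
    #|[set y in e | y %/ 2 ^ i == x %/ 2 ^ i]| == 2]].

Lemma eq_divn_exp2 (i j a b : nat) :
  i <= j -> a %/ 2 ^ i = b %/ 2 ^ i -> a %/ 2 ^ j = b %/ 2 ^ j.
Proof. by move=> le_ij eq_ab; rewrite -(subnKC le_ij) expnD !divnMA eq_ab. Qed.

Lemma divn_expS2 (i a : nat) : a %/ 2 ^ i.+1 = (a %/ 2 ^ i) %/ 2.
Proof. by rewrite expnSr divnMA. Qed.

(* Read e as the leaves of a binary tree: its topmost split is then one against
   three, with v on its own. *)
Lemma dyadic_red_isolated (m N i : nat) (e : {set 'I_N}) (v : 'I_N) :
  #|e| = 4 -> v \in e ->
  {in e, forall y : 'I_N, y %/ 2 ^ i = v %/ 2 ^ i -> y = v} ->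
  {in e, forall y : 'I_N, y %/ 2 ^ i.+1 = v %/ 2 ^ i.+1} ->
  ~~ dyadic_red m e.
Proof.
move=> ce ve alone together.
apply/negP => /existsP[j /forall_inP/(_ v ve)/eqP]; apply/eqP.
have [le_ji | lt_ij] := leqP j i.
  rewrite (_ : [set y in e | _] = [set v]) ?cards1 //.
  apply/setP => y; rewrite !inE; apply/andP/eqP => [[ye /eqP] | ->]; last by [].
  by move/(eq_divn_exp2 le_ji); apply: alone.
rewrite (_ : [set y in e | _] = e) ?ce //.
apply/setP => y; rewrite !inE; case: (boolP (y \in e)) => //= ye; apply/eqP.
exact: eq_divn_exp2 lt_ij (together y ye).
Qed.

(** The topmost split of five leaves has a side [A w] with one or two of them. If one, omitting
    either of two leaves of the other side keeps it isolated; if two, omitting either isolates the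
    other. So two of the five 4-subsets are blue. *)
Lemma dyadic_red_clump (m N : nat) (S : {set 'I_N}) :
  #|S| = 5 -> #|red_subsets (@dyadic_red m N) 4 S| <= 3.
Proof.
move=> cS; pose P j := [forall x in S, forall y in S, x %/ 2 ^ j == y %/ 2 ^ j].
have PE j : reflect {in S &, forall x y : 'I_N, x %/ 2 ^ j = y %/ 2 ^ j} (P j).
  apply: (iffP forall_inP) => [Pj x y xS yS | Pj x xS].
    by have /forall_inP/(_ y yS)/eqP := Pj x xS.
  by apply/forall_inP => y yS; apply/eqP; apply: Pj.
have exP : exists j, P j.
  (* All vertices are below [2 ^ N], so every quotient is 0. *)
  exists N; apply/PE => x y _ _.
  by rewrite !divn_small // (leq_trans (ltn_ord _)) // ltnW // ltn_expl.
case: (ex_minnP exP) => -[|i] /PE Pi minP.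
  have /card_gt1P[x [y [xS yS]]] : 1 < #|S| by rewrite cS.
  by rewrite -val_eqE /= -[val x]divn1 -[val y]divn1 (Pi x y) ?eqxx.
have /PE nPi : ~~ P i by apply/negP => /minP; rewrite ltnn.
pose A (x : 'I_N) := [set z in S | z %/ 2 ^ i == x %/ 2 ^ i].
have [w wS leA] : exists2 w, w \in S & #|A w| <= 2.
  have [x [y [xS yS nxy]]] : exists x y, [/\ x \in S, y \in S & x %/ 2 ^ i != y %/ 2 ^ i].
    apply: NNPP => no_xy; apply: nPi => x y xS yS.
    by apply/eqP/negPn/negP => nxy; apply: no_xy; exists x, y.
  have two z : z \in S -> z %/ 2 ^ i = x %/ 2 ^ i \/ z %/ 2 ^ i = y %/ 2 ^ i.
    move=> zS; have := Pi z x zS xS; have := Pi z y zS yS.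
    by rewrite !divn_expS2; lia.
  have : #|A x| + #|A y| = 5.
    rewrite -cS -cardsUI [A x :&: A y](_ : _ = set0) ?cards0 ?addn0.
      congr #|pred_of_set _|; apply/setP => z; rewrite !inE.
      case: (boolP (z \in S)) => //= /two[] ->; by rewrite eqxx ?orbT.
    apply/setP => z; rewrite !inE; apply/negP => /andP[/andP[_ /eqP->]].
    by rewrite (negbTE nxy) andbF.
  have [le_x _ | lt_x E] := leqP #|A x| 2; first by exists x.
  by exists y => //; lia.
have wA : w \in A w by rewrite inE wS eqxx.
have nonred u v : u \in S -> v \in A w -> u != v ->
    (forall y, y \in A w -> y != u -> y = v) -> ~~ dyadic_red m (S :\ u).
  rewrite inE => uS /andP[vS /eqP vw] uv alone.
  apply: (@dyadic_red_isolated m N i _ v).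
  - by move: cS; rewrite (cardsD1 u) uS => -[].
  - by rewrite in_setD1 eq_sym uv.
  - move=> y; rewrite in_setD1 => /andP[yu yS] yv; apply: alone => //.
    by rewrite inE yS yv vw eqxx.
  - by move=> y; rewrite in_setD1 => /andP[_ yS]; apply: Pi.
have [cA | cA] : #|A w| = 1 \/ #|A w| = 2.
- have : 0 < #|A w| by apply/card_gt0P; exists w.
  by case: #|A w| leA => [|[|[]]] //; [left | right].
- have /eqP/cards1P[w' Aw] := cA.
  have w'w : w' = w by move: wA; rewrite Aw inE => /eqP.
  have /card_gt1P[u [u' [uS u'S uu']]] : 1 < #|S :\ w|.
    by move: cS; rewrite (cardsD1 w) wS add1n => -[->].
  move: uS u'S; rewrite !in_setD1 => /andP[uw uS] /andP[u'w u'S].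
  apply: (red_clump_le uu') => //; apply: (nonred _ w) => // y;
    by rewrite Aw w'w inE => /eqP.
- have /eqP/cards2P[u [v [uv Aw]]] := cA.
  have [uA vA] : u \in A w /\ v \in A w by rewrite Aw !inE !eqxx orbT.
  have [uS vS] : u \in S /\ v \in S by
    move: uA vA; rewrite !inE => /andP[-> _] /andP[-> _].
  apply: (red_clump_le uv) => //.
    by apply: (nonred _ v) => // y; rewrite Aw !inE => /orP[/eqP-> /eqP|/eqP].
  by apply: (nonred _ u); rewrite 1?eq_sym // => y; rewrite Aw !inE => /orP[/eqP|/eqP-> /eqP].
Qed.

Lemma dyadic_red_split (m N i : nat) (a b d e : 'I_N) :
  i < m -> a < b -> d < e -> a %/ 2 ^ i = b %/ 2 ^ i -> d %/ 2 ^ i = e %/ 2 ^ i ->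
  a %/ 2 ^ i <> d %/ 2 ^ i -> dyadic_red m [set y in [:: a; b; d; e]].
Proof.
move=> lt_im lt_ab lt_de eq_ab eq_de /eqP/negbTE neq_ad.
have neq_da : (d %/ 2 ^ i == a %/ 2 ^ i) = false by rewrite eq_sym.
apply/existsP; exists (Ordinal lt_im); apply/forall_inP => x /=; rewrite inE => xs.
have {xs} : x %/ 2 ^ i = a %/ 2 ^ i \/ x %/ 2 ^ i = d %/ 2 ^ i.
  by move: xs; rewrite !inE => /or4P[]/eqP->; rewrite -?eq_ab -?eq_de; tauto.
have ab : #|[set a; b]| == 2 by rewrite cards2 neq_ltn lt_ab.
have de : #|[set d; e]| == 2 by rewrite cards2 neq_ltn lt_de.
case=> ->; [move: ab | move: de]; congr (#|pred_of_set _| == 2); apply/setP => y;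
  rewrite !inE.
  have [->|_] := eqVneq y a; first by rewrite eqxx.
  have [->|_] := eqVneq y b; first by rewrite -eq_ab eqxx.
  have [->|_] := eqVneq y d; first by rewrite ?eqxx ?neq_da ?andbF.
  by have [->|_] := eqVneq y e; first by rewrite -eq_de neq_da ?andbF.
have [->|_] := eqVneq y d; first by rewrite eqxx !orbT.
have [->|_] := eqVneq y e; first by rewrite -eq_de eqxx !orbT.
have [->|_] := eqVneq y a; first by rewrite neq_ad ?andbF.
by have [->|_] := eqVneq y b; first by rewrite -eq_ab neq_ad ?andbF.
Qed.

(** A stretch of a blue path inside one block of size [2 ^ i] has at most [i.+1] vertices, whereas
    the whole path would put [m.+2] vertices into a block of size [2 ^ m]. *)
Lemma not_arrows4 (m N : nat) : N <= 2 ^ m -> ~ arrows 4 5 4 m.+2 N.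
Proof.
move=> leN /(_ (@dyadic_red m N)) [/blue_tight_path_seq|[S [cS]]]; last first.
  by rewrite leqNgt ltnS dyadic_red_clump.
case=> // X [X_inc X_blue].
(* Discarding an end vertex of the path leaves it in a dyadic block of half the
   size, since otherwise the crossing between the two halves is a red window. *)
suff short i p q : i <= m -> p <= q < m.+2 -> X p %/ 2 ^ i = X q %/ 2 ^ i -> q <= p + i.
  have := short m 0 m.+1; rewrite !divn_small; try exact: leq_trans leN.
  by rewrite ltnn => /(_ (leqnn _) (leqnn _) erefl).
elim: i p q => [|i IHi] p q le_im /andP[le_pq lt_q].
  rewrite !divn1 addn0 leqNgt => eq_pq; apply/negP => lt_pq.
  by have := X_inc p q; rewrite eq_pq ltnn lt_pq lt_q => /(_ isT).
rewrite !divn_expS2; pose Y a := X a %/ 2 ^ i; rewrite -/(Y p) -/(Y q) => eq_pq.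
rewrite leqNgt; apply/negP => lt_piq.
have Y_mono a b : a <= b < m.+2 -> Y a <= Y b.
  case/andP; rewrite leq_eqVlt => /orP[/eqP-> //|lt_ab] lt_b.
  by rewrite /Y leq_div2r // ltnW // X_inc ?lt_ab.
(* Contrapositive of the induction hypothesis: positions more than [i] apart lie in different blocks
   of level [i]. *)
have far a b : p <= a -> b <= q -> a + i < b -> Y a < Y b.
  move=> le_pa le_bq lt_ab; rewrite ltn_neqAle Y_mono ?andbT; last by lia.
  by apply/eqP => /(IHi a b (ltnW le_im)) short; have := short _; lia.
have {Y_mono}[Y_mono Y_red] : (forall a b, a <= b < m.+2 -> Y a <= Y b) /\
    (forall j, j + 4 <= m.+2 -> Y j = Y j.+1 -> Y j.+2 = Y j.+3 -> Y j = Y j.+2).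
  split=> // j le_j eq1 eq2; apply/eqP/negPn/negP => /eqP neq.
  apply/negP: (X_blue _ le_j); rewrite negbK /=.
  by apply: (@dyadic_red_split m N i) => //; apply: X_inc; lia.
clear IHi; clearbody Y.
have Mp a : p <= a <= q -> Y p <= Y a <= Y q.
  by move=> le_a; rewrite !Y_mono //; lia.
have two a : p <= a <= q -> Y a = Y p \/ Y a = Y q.
  by move=> /Mp; lia.
have low : Y p.+1 = Y p by have := two p.+1; have := far p.+1 q; lia.
have high : Y q.-1 = Y q by have := two q.-1; have := far p q.-1; lia.
(* The least such [j] is where the path enters the upper half. Since [low] and [high] put two
   positions on each side, the window from [j - 2] to [j + 1] splits two against two. *)
have exj : exists j, (p < j) && (Y j == Y q).
  by exists q.-1; rewrite high eqxx andbT; lia.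
case: (ex_minnP exj) => j /andP[lt_pj /eqP Xj] minj.
have le_jq : j <= q.-1 by apply: minj; rewrite high eqxx andbT; lia.
have lt_pq : Y p < Y q by apply: far; lia.
have lt_p1j : p.+1 < j.
  by rewrite ltn_neqAle lt_pj andbT; apply/eqP => Ej; move: Xj; rewrite -Ej low; lia.
have lowj a : p < a < j -> Y a = Y p.
  move=> lt_a; case: (two a) => // [|Xa]; first by lia.
  by have := minj a; rewrite Xa eqxx andbT; lia.
have lowj2 : Y j.-2 = Y p.
  have [->//|lt] : j.-2 = p \/ p < j.-2 < j by lia.
  exact: lowj.
have [j' Ej] : exists j', j = j'.+2 by exists j.-2; lia.
subst j; rewrite /= in lowj2.
suff : Y j' = Y j'.+2 by lia.
apply: Y_red; [lia | rewrite (lowj j'.+1) //; lia |].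
by apply/eqP; rewrite eqn_leq {2}Xj !Y_mono //; lia.
Qed.

(** * The three bounds for the Ramsey numbers *)

Theorem theorem5 :
  (forall k n : nat, 3 <= k -> k <= n ->
     exists r : nat, is_ramsey_number k k.+1 3 n r /\ r <= 16 * n) /\
  (forall n : nat, 3 <= n ->
     exists r : nat, is_ramsey_number 3 4 3 n r /\ 2 * n - 2 <= r <= 3 * n - 4) /\
  (forall n : nat, 2 <= n ->
     exists r : nat, is_ramsey_number 4 5 4 n r /\ 2 ^ (n - 2) + 1 <= r).
Proof.
split; [|split] => [k n le3k le_kn | n le3n | n le2n].
- have ar := arrows_clump3 le3k le_kn.
  have [r [ar_r min_r]] := ex_least ar.
  by exists r; split=> //; apply: leq_trans (min_r _ ar) _; lia.
- have ar := arrows_clump3 (leqnn 3) le3n.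
  have [r [ar_r min_r]] := ex_least ar.
  exists r; split=> //; apply/andP; split; last by have := min_r _ ar; lia.
  by rewrite leqNgt; apply/negP => lt_r; apply: not_arrows3 ar_r => //; lia.
(* Here ['C(5, 4)] is 5, and five red edges are in particular four. *)
- have [N ar] := @arrows_clique 4 5 n isT.
  have {ar}ar : arrows 4 5 4 n N.
    move=> c; case: (ar c) => [|[S [cS le5]]]; [left | right] => //.
    by exists S; split=> //; apply: ltnW.
  have [r [ar_r min_r]] := ex_least ar.
  exists r; split=> //; rewrite addn1 ltnNge; apply/negP => le_r.
  by apply: (@not_arrows4 (n - 2) r le_r); rewrite (_ : (n - 2).+2 = n) //; lia.
Qed.
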